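(* Let $(X,d)$ be an ultrametric space, i.e. a metric space with $d(x,y)\le \max(d(x,z),d(y,z))$ for all $x,y,z\in X$. For any integers $n>m\ge 1$ and any real $L>1$ there exists a retraction $\mathcal R\colon X(n)\to X(m)$ with $\operatorname{Lip}(\mathcal R)\le L$. If $X$ is compact, one can take $L=1$ (i.e. for any $n>m\ge1$ there exists a retraction $\mathcal R\colon X(n)\to X(m)$ with $\operatorname{Lip}(\mathcal R)\le 1$).
   Context: For a metric space $(X,d)$ and a positive integer $n$, $X(n)=\{A\subset X\colon 1\le |A|\le n\}$, equipped with the Hausdorff metric $\Delta(A,B)=\max\left(\sup_{a\in A}\operatorname{dist}(a,B),\ \sup_{b\in B}\operatorname{dist}(b,A)\right)$. For $m<n$, $X(m)$ is a subset of $X(n)$. A retraction $\mathcal R\colon X(n)\to X(m)$ is a map whose restriction to $X(m)$ is the identity. $\operatorname{Lip}(\mathcal R)$ is the least $L\ge 0$ such that $\Delta(\mathcal R(A),\mathcal R(B))\le L\,\Delta(A,B)$ for all $A,B\in X(n)$. *)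

(* Defs.v *)
From mathcomp Require Import all_boot all_order all_algebra finmap.
From mathcomp Require Import all_classical all_reals all_analysis.

Set Implicit Arguments.
Unset Strict Implicit.
Unset Printing Implicit Defensive.

Import Order.TTheory GRing.Theory Num.Theory.

Local Open Scope classical_set_scope.
Local Open Scope ring_scope.

Definition ultrametric (R : realType) (X : metricType R) : Prop :=
  forall x y z : X, mdist x y <= Num.max (mdist x z) (mdist y z).

(* X(n); the inclusion of X(m) in X(n) is on the underlying sets [val A] *)
Definition finsub (R : realType) (X : metricType R) (n : nat) : Type :=
  {A : {fset X} | (1 <= #|` A| <= n)%N}.

Definition dist_set (R : realType) (X : metricType R) (x : X) (B : set X) : R :=
  inf [set mdist x b | b in B].

(* [sup] and [inf] are real-valued, with value 0 when they do not exist; here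
   they are only taken over finite nonempty sets. *)
Definition hausdorff_dist (R : realType) (X : metricType R) (A B : {fset X}) : R :=
  Num.max (sup [set dist_set a [set` B] | a in [set` A]])
          (sup [set dist_set b [set` A] | b in [set` B]]).

Definition retraction (R : realType) (X : metricType R) (n m : nat)
    (r : finsub X n -> finsub X m) : Prop :=
  forall (A : finsub X n) (B : finsub X m), val A = val B -> r A = B.

(* The infimum is in [\bar R], so that a map that is not Lipschitz has
   constant +oo; it is a minimum for a Lipschitz map. *)
Definition lip (R : realType) (X : metricType R) (n m : nat)
    (r : finsub X n -> finsub X m) : \bar R :=
  ereal_inf [set L%:E | L in
    [set L : R | 0 <= L /\ forall A B : finsub X n,
       hausdorff_dist (val (r A)) (val (r B))
         <= L * hausdorff_dist (val A) (val B)]].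

(* Main.v *)
(* Under the Hausdorff metric X(n) is again ultrametric, and X(m) is proximinal
   in it: a nearest element of X(m) to A can be found among the subsets of A, so
   no compactness is needed and the constant 1 is always attained.  A proximinal
   subset Z of an ultrametric space is a 1-Lipschitz retract: away from Z, the
   balls B(y, dist(y, Z)) form a partition on each block of which the distance
   to Z is constant; map a whole block to a point of Z nearest to one chosen
   element.  Points y, y' in different blocks satisfy
   d(y, y') >= max(dist(y, Z), dist(y', Z)), which bounds the distance of their
   images. *)
Require Import Defs.
From mathcomp Require Import all_boot all_order all_algebra finmap.
From mathcomp Require Import all_classical all_reals all_analysis.

Set Implicit Arguments.
Unset Strict Implicit.
Unset Printing Implicit Defensive.

Local Open Scope classical_set_scope.
Local Open Scope ring_scope.

Import Order.TTheory GRing.Theory Num.Theory.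

Section UltrametricRetract.
Variables (R : realDomainType) (Y Z : Type) (d : Y -> Y -> R) (i : Z -> Y).
Hypothesis d_refl : forall y, d y y = 0.
Hypothesis d_sym : forall y y', d y y' = d y' y.
Hypothesis d_sep : forall y y', d y y' <= 0 -> y = y'.
Hypothesis d_ultra : forall x y z, d x y <= Num.max (d x z) (d z y).
Hypothesis i_inj : injective i.
Hypothesis i_prox : forall y, exists z, forall z', d y (i z) <= d y (i z').

Lemma proximinal_retract : exists r : Y -> Z,
  (forall z, r (i z) = z) /\ (forall y y', d (i (r y)) (i (r y')) <= d y y').
Proof.
have d_ge0 y y' : 0 <= d y y'.
  by have := d_ultra y y y'; rewrite d_refl (d_sym y' y) maxxx.
have [near nearP] := choice i_prox.
pose delta y := d y (i (near y)).
(* The nearest point to [y'] competes for [y]; this is the ultrametric form of the distance to a set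
   being 1-Lipschitz. *)
have delta_le y y' : delta y <= Num.max (d y y') (delta y').
  exact: le_trans (nearP y (near y')) (d_ultra y (i (near y')) y').
(* The disjunct [u = y] matters only when [delta y = 0]. *)
pose C y := [set u | u = y \/ d y u < delta y].
(* Every point of an ultrametric ball is a centre of it. The reverse inclusion reuses [sub], since
   [delta y <= delta y'] keeps [y] within [delta y'] of [y']. *)
have C_eq y y' : d y y' < delta y -> C y = C y'.
  have sub v v' : d v v' < delta v -> C v `<=` C v'.
    move=> vv'; have le_delta : delta v <= delta v'.
      have := delta_le v v'; rewrite le_max => /orP[h|//].
      by have := le_lt_trans h vv'; rewrite ltxx.
    move=> u [->|vu]; right.
      by rewrite d_sym; exact: lt_le_trans vv' le_delta.
    apply: le_lt_trans (d_ultra v' u v) _; rewrite gt_max (d_sym v').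
    by rewrite !(lt_le_trans _ le_delta).
  move=> yy'; apply/seteqP; split; first exact: sub.
  apply: sub; rewrite d_sym; apply: (lt_le_trans yy').
  have := delta_le y y'; rewrite le_max => /orP[h|//].
  by have := le_lt_trans h yy'; rewrite ltxx.
have C_ne y : C y !=set0 by exists y; left.
(* The representative depends on the set [C y] alone, so [r] is constant on each block. *)
have [rep repP] := choice (fun S : {S : set Y | S !=set0} => svalP S).
pose r y := near (rep (exist _ (C y) (C_ne y))).
have dr y : d y (i (r y)) <= delta y.
  have := repP (exist _ (C y) (C_ne y)); rewrite /r.
  set p := rep _; move=> /= [->//|yp].
  have le_p : delta p <= delta y.
    by apply: le_trans (delta_le p y) _; rewrite ge_max d_sym (ltW yp) lexx.
  by apply: le_trans (d_ultra _ _ p) _; rewrite ge_max (ltW yp).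
exists r; split=> [z|y y'].
  (* Here [delta (i z)] is 0, because [z] itself competes. *)
  apply/i_inj/esym/d_sep/(le_trans (dr (i z))).
  by apply: le_trans (nearP (i z) z) _; rewrite d_refl.
have r_eq v v' : d v v' < delta v -> r v = r v'.
  by move=> /C_eq vv'; rewrite /r; congr (near (rep _)); exact: eq_exist.
(* Within one block the images coincide. Otherwise both deltas are at most [d y y'], and the
   ultrametric inequality along [i (r y)], [y], [y'], [i (r y')] concludes. *)
have [/r_eq ->|le_y] := ltP (d y y') (delta y); first by rewrite d_refl.
have [|le_y'] := ltP (d y y') (delta y').
  by rewrite d_sym => /r_eq ->; rewrite d_refl.
apply: le_trans (d_ultra _ _ y) _; rewrite ge_max (d_sym _ y).
rewrite (le_trans (dr y))//=; apply: le_trans (d_ultra _ _ y') _.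
by rewrite ge_max lexx (le_trans (dr y')).
Qed.

End UltrametricRetract.

Lemma fset_arg_min (R : realDomainType) (K : choiceType) (B : {fset K})
    (f : K -> R) :
  B != fset0 -> exists2 b, b \in B & forall b', b' \in B -> f b <= f b'.
Proof.
move=> /fset0Pn[b0 b0B].
case: (@arg_minP _ _ B [` b0B]%fset xpredT (fun b => f (val b)) isT) => b _ bP.
by exists (val b) => [|b' b'B]; [exact: valP | exact: (bP [` b'B]%fset)].
Qed.

Section FiniteSets.
Variables (R : realType).

(** A finite nonempty infimum is attained, so a single point witnesses the bound; nonemptiness
    excludes the default value 0 of [inf]. *)
Lemma fset_inf_leP (K : choiceType) (B : {fset K}) (f : K -> R) (t : R) :
  B != fset0 ->
  inf [set f b | b in [set` B]] <= t <-> exists2 b, b \in B & f b <= t.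
Proof.
move=> B0; have [b0 b0B b0P] := @fset_arg_min R K B f B0.
have lbB : lbound [set f b | b in [set` B]] (f b0).
  by move=> _ [b /= bB <-]; exact: b0P.
split=> [le_t|[b bB]].
  exists b0 => //; apply: le_trans le_t; apply: lb_le_inf => //.
  by exists (f b0), b0.
by apply: le_trans; apply: ge_inf; [exists (f b0) | exists b].
Qed.

Lemma fset_sup_leP (K : choiceType) (A : {fset K}) (f : K -> R) (t : R) :
  A != fset0 ->
  sup [set f a | a in [set` A]] <= t <-> forall a, a \in A -> f a <= t.
Proof.
move=> A0; have [a0 a0A a0P] := @fset_arg_min R K A (fun a => - f a) A0.
split=> [le_t a aA|le_t].
  apply: le_trans le_t; apply: ub_le_sup; last by exists a.
  by exists (f a0) => _ [b /= bA <-]; rewrite -lerN2; exact: a0P.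
apply: ge_sup; first by exists (f a0), a0.
by move=> _ [a /= aA <-]; exact: le_t.
Qed.

Variable X : metricType R.
Implicit Types (A B C : {fset X}) (n m : nat).

(** Replaces suprema and infima by witnesses; taking [t] to be the distance itself loses no
    epsilon. *)
Lemma hausdorff_leP A B t : A != fset0 -> B != fset0 ->
  hausdorff_dist A B <= t <->
  (forall a, a \in A -> exists2 b, b \in B & mdist a b <= t) /\
  (forall b, b \in B -> exists2 a, a \in A & mdist b a <= t).
Proof.
move=> A0 B0; rewrite /hausdorff_dist ge_max; split=> [/andP[]|[AB BA]].
  move=> /(fset_sup_leP _ _ A0) AB /(fset_sup_leP _ _ B0) BA.
  by split=> x xP; apply/fset_inf_leP => //; [exact: AB | exact: BA].
apply/andP; split; apply/fset_sup_leP => // x xP; apply/fset_inf_leP => //.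
  exact: AB.
exact: BA.
Qed.

Lemma hausdorff_sym A B : hausdorff_dist A B = hausdorff_dist B A.
Proof. by rewrite /hausdorff_dist maxC. Qed.

Lemma hausdorff_ge0 A B : A != fset0 -> B != fset0 -> 0 <= hausdorff_dist A B.
Proof.
move=> A0 B0; have [AB _] := iffLR (hausdorff_leP _ A0 B0) (lexx _).
have /fset0Pn[a /AB[b _]] := A0; exact: le_trans (mdist_ge0 _ _).
Qed.

Lemma hausdorff_refl A : A != fset0 -> hausdorff_dist A A = 0.
Proof.
move=> A0; apply/le_anti; rewrite hausdorff_ge0// andbT; apply/hausdorff_leP => //.
by split=> a aA; exists a; rewrite // mdistxx.
Qed.

Lemma hausdorff_sep A B : A != fset0 -> B != fset0 ->
  hausdorff_dist A B <= 0 -> A = B.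
Proof.
move=> A0 B0 /hausdorff_leP[]// AB BA; have sep (x y : X) : mdist x y <= 0 -> x = y.
  by move=> xy0; apply: mdist_positivity; apply/le_anti; rewrite xy0 mdist_ge0.
by apply/fsetP => x; apply/idP/idP => [/AB|/BA][y yP /sep ->].
Qed.

Hypothesis hX : ultrametric X.

Lemma hausdorff_ultra A B C : A != fset0 -> B != fset0 -> C != fset0 ->
  hausdorff_dist A B <= Num.max (hausdorff_dist A C) (hausdorff_dist C B).
Proof.
move=> A0 B0 C0.
have [AC CA] := iffLR (hausdorff_leP _ A0 C0) (lexx _).
have [CB BC] := iffLR (hausdorff_leP _ C0 B0) (lexx _).
apply/hausdorff_leP => //; split=> x.
  move=> /AC[c /CB[y yB cy] xc]; exists y => //.
  apply: le_trans (hX _ _ c) _; rewrite (metric_sym y) ge_max.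
  by apply/andP; split; rewrite le_max ?xc ?cy ?orbT.
move=> /BC[c /CA[y yA cy] xc]; exists y => //.
apply: le_trans (hX _ _ c) _; rewrite (metric_sym y) ge_max.
by apply/andP; split; rewrite le_max ?xc ?cy ?orbT.
Qed.

Lemma finsub_neq0 n (A : finsub X n) : val A != fset0.
Proof. by rewrite -cardfs_gt0; case/andP: (valP A). Qed.

(* Moving each point of a competitor [B'] to a nearest point of [A] does not
   increase the distance to [A]. *)
Lemma finsub_proximinal n m (A : finsub X n) : (1 <= m)%N ->
  exists B : finsub X m, forall B' : finsub X m,
    hausdorff_dist (val A) (val B) <= hausdorff_dist (val A) (val B').
Proof.
move=> m_gt0; have A0 := finsub_neq0 A.
(* Only finitely many candidates lie inside [A], so a closest one exists; singletons make the family
   nonempty as [m] is positive. *)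
pose P := [fset S in fpowerset (val A) | (1 <= #|` S| <= m)%N]%fset.
have P0 : P != fset0.
  have /fset0Pn[a aA] := A0; apply/fset0Pn; exists [fset a]%fset.
  by rewrite !inE/= fpowersetE fsub1set aA cardfs1.
have [B BP Bmin] := @fset_arg_min R _ P (hausdorff_dist (val A)) P0.
have Bcard : (1 <= #|` B| <= m)%N by move: BP; rewrite !inE => /andP[].
exists (exist _ B Bcard) => B' /=; have B'0 := finsub_neq0 B'.
have [AB' B'A] := iffLR (hausdorff_leP _ A0 B'0) (lexx _).
(* Outside [B'] the value of [g] is arbitrary. *)
have /choice[g gP] : forall b, exists a, b \in val B' ->
    a \in val A /\ mdist b a <= hausdorff_dist (val A) (val B').
  move=> b; have [/B'A[a aA ba]|/negP bB'] := boolP (b \in val B').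
    by exists a.
  by exists b.
pose S := [fset g b | b in val B']%fset.
have S0 : S != fset0.
  by have /fset0Pn[b bB'] := B'0; apply/fset0Pn; exists (g b); rewrite in_imfset.
have SA : (S `<=` val A)%fset.
  by apply/fsubsetP => _ /imfsetP[b /= bB' ->]; case: (gP b bB').
apply: le_trans (Bmin S _) _.
  rewrite !inE/= fpowersetE SA cardfs_gt0 S0 /=.
  have /andP[_] := valP B'; apply: leq_trans; exact: leq_imfset_card.
(* A point of [S] lies in [A], at distance 0 from itself. From [a], the path to [g b] through [b]
   has both steps within the distance from [A] to [B']. *)
apply/hausdorff_leP => //; split=> [a /AB'[b bB' ab]|s sS]; last first.
  exists s; first exact: (fsubsetP SA).
  by rewrite mdistxx hausdorff_ge0.
exists (g b); first by rewrite in_imfset.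
have [_ bg] := gP b bB'.
by apply: le_trans (hX _ _ b) _; rewrite ge_max ab metric_sym.
Qed.

Lemma finsub_retract n m : (1 <= m)%N -> (m <= n)%N ->
  exists r : finsub X n -> finsub X m, retraction r /\ (lip r <= 1%:E)%E.
Proof.
move=> m_gt0 le_mn.
have cardW (B : finsub X m) : (1 <= #|` val B| <= n)%N.
  by have /andP[-> /leq_trans->] := valP B.
pose i (B : finsub X m) : finsub X n := exist _ (val B) (cardW B).
have [] := @proximinal_retract R (finsub X n) (finsub X m)
  (fun A B : finsub X n => hausdorff_dist (val A) (val B)) i.
- by move=> A; exact/hausdorff_refl/finsub_neq0.
- by move=> A B; exact: hausdorff_sym.
- by move=> A B AB; apply/val_inj/hausdorff_sep => //; exact: finsub_neq0.
- by move=> A B C; apply: hausdorff_ultra; exact: finsub_neq0.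
- by move=> B B' /(congr1 val) /= /val_inj.
- by move=> A; exact: finsub_proximinal.
move=> r [ri r1]; exists r; split=> [A B AB|].
  by rewrite -[RHS]ri; congr r; exact: val_inj.
apply: ereal_inf_lbound; exists 1 => //; split=> // A B.
by rewrite mul1r; exact: r1.
Qed.

End FiniteSets.

Theorem theorem3p1 (R : realType) (X : metricType R) (hX : ultrametric X) :
  (forall (n m : nat) (L : R), (1 <= m)%N -> (m < n)%N -> 1 < L ->
     exists r : finsub X n -> finsub X m,
       retraction r /\ (lip r <= L%:E)%E) /\
  (compact [set: X] ->
   forall n m : nat, (1 <= m)%N -> (m < n)%N ->
     exists r : finsub X n -> finsub X m,
       retraction r /\ (lip r <= 1%:E)%E).
Proof.
split=> [n m L m_gt0 /ltnW mn L1|_ n m m_gt0 /ltnW mn]; last first.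
  exact: finsub_retract.
have [r [rr r1]] := finsub_retract hX m_gt0 mn.
by exists r; split=> //; apply: le_trans r1 _; rewrite lee_fin ltW.
Qed.
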